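(* Let $G$ be an $n$-vertex graph with $\alpha(G)=2$ and $$\omega(G)<\begin{cases}\lceil \frac n4\rceil, & \text{if } n \text{ is even},\\ \lceil \frac{n+3}4\rceil, & \text{if } n \text{ is odd}.\end{cases}$$ Then $G$ contains $K_{\lceil n/2\rceil}$ as a totally odd immersion.
   Context: All graphs are finite and simple (no loops, no parallel edges). $\alpha(G)$ denotes the independence number of $G$ (maximum size of a set of pairwise non-adjacent vertices), $\omega(G)$ the clique number of $G$ (maximum size of a set of pairwise adjacent vertices), and $K_t$ is the complete graph on $t$ vertices. The length of a path is its number of edges. Immersion: $G$ contains a graph $H$ as an immersion if there exists a one-to-one mapping $\varphi\colon V(H)\to V(G)$ such that: (I) for every $uv\in E(H)$ there is a path in $G$, denoted $P_{uv}$, with endpoints $\varphi(u)$ and $\varphi(v)$; (II) the paths in $\{P_{uv}\mid uv\in E(H)\}$ are pairwise edge-disjoint; (III) the vertices of $\varphi(V(H))$ (called terminals) do not appear as internal vertices of the paths $P_{uv}$. $G$ contains $H$ as a totally odd immersion if $G$ contains $H$ as an immersion where all the corresponding paths $P_{uv}$ have odd length. *)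

(* Defs.v *)
From mathcomp Require Import all_boot.

Set Implicit Arguments.
Unset Strict Implicit.
Unset Printing Implicit Defensive.

Record sgraph := SGraph {
  vertex :> finType;
  adj : rel vertex;
  adj_sym : symmetric adj;
  adj_irrefl : irreflexive adj
}.

Section Graph.
Variable G : sgraph.

Definition edges : {set {set G}} :=
  [set [set uv.1; uv.2] | uv : G * G & adj uv.1 uv.2].

Definition stable (S : {set G}) : bool :=
  [forall x in S, forall y in S, ~~ adj x y].

Definition clique (S : {set G}) : bool :=
  [forall x in S, forall y in S, (x != y) ==> adj x y].

Definition alpha : nat := \max_(S : {set G} | stable S) #|S|.

Definition omega : nat := \max_(S : {set G} | clique S) #|S|.

(* A path is represented by the sequence of its vertices, in order. *)
Definition is_gpath (s : seq G) : bool :=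
  if s is x :: p then path (@adj G) x p && uniq s else false.

Definition path_edges (s : seq G) : seq {set G} :=
  [seq [set xy.1; xy.2] | xy <- zip s (behead s)].

Definition path_length (s : seq G) : nat := size (path_edges s).

Definition endpoints (s : seq G) : {set G} :=
  if s is x :: p then [set x; last x p] else set0.

Definition internal (s : seq G) : seq G :=
  if s is x :: p then behead (belast x p) else [::].

End Graph.

Lemma complete_sym (t : nat) : symmetric (fun i j : 'I_t => i != j).
Proof. by move=> i j; rewrite eq_sym. Qed.

Lemma complete_irrefl (t : nat) : irreflexive (fun i j : 'I_t => i != j).
Proof. by move=> i; rewrite eqxx. Qed.

Definition complete (t : nat) : sgraph :=
  SGraph (@complete_sym t) (@complete_irrefl t).

(* One path [P e] per unordered edge [e] of [H]; the values of [P] outside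
   [edges H] are irrelevant. *)
Definition is_immersion (H G : sgraph) (phi : H -> G)
    (P : {set H} -> seq G) : Prop :=
  [/\ injective phi,
      forall u v : H, adj u v ->
        is_gpath (P [set u; v])
        /\ endpoints (P [set u; v]) = [set phi u; phi v],
      forall e f : {set H}, e \in edges H -> f \in edges H -> e != f ->
        forall d : {set G}, d \in path_edges (P e) -> d \notin path_edges (P f)
    & forall (e : {set H}) (w : H), e \in edges H ->
        phi w \notin internal (P e)].

Definition contains_immersion (H G : sgraph) : Prop :=
  exists (phi : H -> G) (P : {set H} -> seq G), is_immersion phi P.

Definition contains_totally_odd_immersion (H G : sgraph) : Prop :=
  exists (phi : H -> G) (P : {set H} -> seq G),
    is_immersion phi P
    /\ forall e : {set H}, e \in edges H -> odd (path_length (P e)).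

(* The ceiling of m / d, for d > 0. *)
Definition ceil_div (m d : nat) : nat := (m + d.-1) %/ d.

(* Main.v *)
Require Import Defs.
From mathcomp Require Import all_boot zify.

Set Implicit Arguments.
Unset Strict Implicit.
Unset Printing Implicit Defensive.

(* Take a maximum matching [v -- f v] of the complement of [G], with set [U] of
   unmatched vertices ([f v = v]).  By maximality, each matched pair has an end
   adjacent in [G] to all of [U]; let [X] contain one such end of each pair, and
   let the terminals be [X] and half of the clique [U].  Since [alpha G = 2],
   nonadjacent terminals [u], [v] lie in [X], and [u ~ f v], [v ~ f u]; if also
   [f u ~ f v], join them by [u, f v, f u, v].  Otherwise use [u, k, f u, v] (or
   the same with [u], [v] exchanged) for a nonterminal [k] such that [u] and
   [f u] are both adjacent to both of [k] and [f k].  The middle edge [{k, f u}]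
   determines which pair may use the first edge [{u, k}], so it is enough that
   distinct pairs get distinct middle edges.  Hall's theorem provides them: the
   nonneighbours of a vertex form a clique, so twice [omega G] bounds the
   nonneighbours of [u] and [f u] together, and this yields at least as many
   candidates [k] at [u] as there are blocked pairs at [u]. *)

(** * Hall's theorem *)

Section Hall.
Variables (A B : finType) (D : {set A}).

Definition hall_condition (F : A -> {set B}) : bool :=
  [forall S : {set A}, (S \subset D) ==> (#|S| <= #|\bigcup_(a in S) F a|)].

Lemma hall_conditionP (F : A -> {set B}) :
  reflect (forall S : {set A}, S \subset D -> #|S| <= #|\bigcup_(a in S) F a|)
    (hall_condition F).
Proof.
by apply: (iffP forallP) => hF S; [move/implyP: (hF S) | apply/implyP/hF].
Qed.

Definition shrink (F : A -> {set B}) (a : A) (b : B) : A -> {set B} :=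
  fun x => if x == a then F a :\ b else F x.

(** A violating set must contain [a], since the family is unchanged elsewhere; [S] is that set
    without [a], which turns the strict inequality into a weak one. *)
Lemma shrink_violated (F : A -> {set B}) (a : A) (b : B) :
  hall_condition F -> ~~ hall_condition (shrink F a b) ->
  exists S : {set A}, [/\ S \subset D, a \notin S &
    #|(\bigcup_(x in S) F x) :|: (F a :\ b)| <= #|S|].
Proof.
move=> /hall_conditionP hF /forallPn[S]; rewrite negb_imply -ltnNge.
case/andP=> sSD lt_S.
have shE (X : {set A}) : a \notin X ->
    \bigcup_(x in X) shrink F a b x = \bigcup_(x in X) F x.
  move=> aX; apply: eq_bigr => x xX; rewrite /shrink.
  by case: eqP xX aX => // -> ->.
have aS : a \in S.
  by apply: contraLR lt_S => aS; rewrite -leqNgt shE // hF.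
exists (S :\ a); split; last 2 first.
- by rewrite !inE eqxx.
- move: lt_S; rewrite (big_setD1 a) //= shE; last by rewrite !inE eqxx.
  by rewrite {1}/shrink eqxx setUC (cardsD1 a S) aS.
exact: subset_trans (subD1set _ _) sSD.
Qed.

(* Rado's argument: by submodularity, one of any two elements of [F a] can be
   dropped without violating Hall's condition. *)
Lemma hall_shrink (F : A -> {set B}) (a : A) (b c : B) :
  hall_condition F -> a \in D -> b != c ->
  hall_condition (shrink F a b) || hall_condition (shrink F a c).
Proof.
move=> hF aD neq_bc; apply: contraT; rewrite negb_or.
case/andP=> /(shrink_violated hF)[S [sSD aS leS]].
case/(shrink_violated hF)=> R [sRD aR leR].
move/hall_conditionP: hF => hF.
set X := _ :|: _ in leS; set Y := _ :|: _ in leR.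
(* As [b != c], the set [X :|: Y] contains all of [F a], so Hall's condition applies with [a] added;
   this is the strict inequality that contradicts [leS] and [leR]. *)
have hU : #|S :|: R| < #|X :|: Y|.
  have aSR : a \notin S :|: R by rewrite inE negb_or aS.
  have := hF (a |: (S :|: R)); rewrite !subUset sub1set aD sSD sRD cardsU1 aSR.
  move=> /(_ isT) /leq_trans; apply; apply: subset_leq_card.
  apply/bigcupsP => x; rewrite !inE => xSR; apply/subsetP => y yF.
  rewrite !inE; case/or3P: xSR => [/eqP xa | xS | xR].
  - rewrite -xa yF !andbT; case: (eqVneq y b) => [-> | _]; last by rewrite !orbT.
    by rewrite neq_bc !orbT.
  - by rewrite (_ : y \in \bigcup_(x in S) F x) //; apply/bigcupP; exists x.
  - by rewrite (_ : y \in \bigcup_(x in R) F x) ?orbT //; apply/bigcupP; exists x.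
have hI : #|S :&: R| <= #|X :&: Y|.
  apply: leq_trans (hF _ _) (subset_leq_card _).
    by apply: subset_trans (subsetIl _ _) sSD.
  apply/bigcupsP => x; rewrite inE => /andP[xS xR]; apply/subsetP => y yF.
  rewrite !inE; apply/andP; split; apply/orP; left; apply/bigcupP.
    by exists x.
  by exists x.
have := cardsUI S R; have := cardsUI X Y; lia.
Qed.

(** Dropping elements one at a time leaves singletons, and Hall's condition on two-element sets then
    makes the choice injective. [b0] is a default for empty sets, which occur only off [D]. *)
Lemma hall (b0 : B) (F : A -> {set B}) :
  (forall S : {set A}, S \subset D -> #|S| <= #|\bigcup_(a in S) F a|) ->
  exists h : A -> B, {in D, forall a, h a \in F a} /\ {in D &, injective h}.
Proof.
move/hall_conditionP.
have [n] := ubnP (\sum_(a in D) #|F a|); elim: n F => // n IHn F le_n hF.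
have [/existsP[a /andP[aD]] | /existsPn noa] :=
  boolP [exists a, (a \in D) && (1 < #|F a|)].
  case/card_gt1P=> b [c [bF cF neq_bc]].
  suff go d : d \in F a -> hall_condition (shrink F a d) ->
      exists h : A -> B, {in D, forall a, h a \in F a} /\ {in D &, injective h}.
    by case/orP: (hall_shrink hF aD neq_bc) => /go; apply.
  move=> dF /IHn[|h [hF' hinj]].
    apply: leq_trans (_ : \sum_(a in D) #|F a| <= n) => //.
    rewrite (bigD1 a) //= [X in _ < X](bigD1 a) //= -addSn leq_add //.
      by rewrite /shrink eqxx (cardsD1 d (F a)) dF.
    apply: leq_sum => x /andP[_ /negPf xa]; by rewrite /shrink xa.
  exists h; split=> // x /hF'; rewrite /shrink.
  by case: eqP => [->|//]; rewrite inE => /andP[].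
move/hall_conditionP: hF => hF.
have h1 a : a \in D -> exists b, F a = [set b].
  move=> aD; apply/cards1P; rewrite eqn_leq; apply/andP; split.
    by have := noa a; rewrite aD -leqNgt.
  by have := hF [set a]; rewrite sub1set aD cards1 big_set1; apply.
pose h a := odflt b0 [pick b in F a].
have hE a : a \in D -> F a = [set h a].
  move=> /h1[b Fa]; rewrite /h; case: pickP => [c | /(_ b)].
    by rewrite Fa inE => /eqP ->.
  by rewrite Fa inE eqxx.
exists h; split=> [a aD | a a' aD aD' eq_h]; first by rewrite hE ?inE.
apply/eqP; apply: contraT => neq.
have := hF [set a; a']; rewrite subUset !sub1set aD aD' cards2 neq.
by rewrite big_setU1 ?inE //= big_set1 !hE // eq_h setUid cards1; apply.
Qed.

End Hall.

(** * Immersions of complete graphs from systems of paths *)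

Lemma immersion_of_paths (G : sgraph) (T : {set G}) (Q : {set G} -> seq G) :
  (forall u v, u \in T -> v \in T -> u != v ->
    [/\ is_gpath (Q [set u; v]), endpoints (Q [set u; v]) = [set u; v],
        odd (path_length (Q [set u; v])) &
        {in internal (Q [set u; v]), forall w, w \notin T}]) ->
  (forall u v u' v', u \in T -> v \in T -> u != v ->
     u' \in T -> v' \in T -> u' != v' -> [set u; v] != [set u'; v'] ->
     forall d, d \in path_edges (Q [set u; v]) ->
       d \notin path_edges (Q [set u'; v'])) ->
  contains_totally_odd_immersion (complete #|T|) G.
Proof.
move=> hQ disjQ; pose phi (i : complete #|T|) : G := enum_val (i : 'I_#|T|).
have phiT i : phi i \in T by apply: enum_valP.
have phiI : injective phi by apply: enum_val_inj.
have edgeE (e : {set complete #|T|}) : e \in edges (complete #|T|) ->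
    exists i j, [/\ i != j, phi i != phi j, e = [set i; j]
                  & phi @: e = [set phi i; phi j]].
  case/imsetP=> -[i j]; rewrite inE /= => neq ->; exists i, j.
  by rewrite (inj_eq phiI) imsetU !imset_set1.
exists phi, (fun e : {set complete #|T|} => Q (phi @: e)); split; first split=> //.
- move=> u v neq; rewrite ?imsetU ?imset_set1.
  by have [] := hQ _ _ (phiT u) (phiT v); rewrite ?(inj_eq phiI).
- move=> e f /edgeE[i [j [_ nij -> E]]] /edgeE[i' [j' [_ nij' -> E']]] neq d.
  rewrite E E'; apply: disjQ => //.
  by rewrite -E -E' (inj_eq (imset_inj phiI)).
- move=> e w /edgeE[i [j [_ nij _ ->]]]; apply/negP.
  have [_ _ _ int] := hQ _ _ (phiT i) (phiT j) nij.
  by move/int; rewrite phiT.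
- move=> e /edgeE[i [j [_ nij _ ->]]].
  by have [] := hQ _ _ (phiT i) (phiT j) nij.
Qed.

(** * Graphs of independence number two *)

Lemma alpha2_adj (G : sgraph) (a b c : G) :
  alpha G = 2 -> a != b -> b != c -> ~~ adj a b -> ~~ adj b c -> a != c ->
  adj a c.
Proof.
move=> alpha_G ab bc nab nbc ac; apply: contraT => nac.
suff st : stable [set a; b; c].
  have : #|[set a; b; c]| <= alpha G by exact: (leq_bigmax_cond _ st).
  rewrite alpha_G (setUC [set a; b]) cardsU1 cards2 !inE ab.
  by rewrite (eq_sym c) (negPf ac) (eq_sym c) (negPf bc).
have sym := @adj_sym G; have irr := @adj_irrefl G.
apply/forall_inP => x; rewrite !inE -orbA => /or3P[] /eqP ->;
  apply/forall_inP => y; rewrite !inE -orbA => /or3P[] /eqP ->;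
  by rewrite ?irr // sym.
Qed.

Lemma card_nonneighbors (G : sgraph) (v : G) :
  alpha G = 2 -> #|[set w | (w != v) && ~~ adj v w]| <= omega G.
Proof.
move=> alpha_G.
suff cl : clique [set w | (w != v) && ~~ adj v w].
  exact: (leq_bigmax_cond _ cl).
apply/forall_inP => x; rewrite !inE => /andP[xv nvx].
apply/forall_inP => y; rewrite !inE => /andP[yv nvy]; apply/implyP.
by apply: (alpha2_adj alpha_G xv _ _ nvy); rewrite 1?eq_sym // adj_sym.
Qed.

(** * Maximum matchings of the complement *)

(** Encodes a matching of the complement: matched vertices are swapped and unmatched ones fixed, so
    a maximum matching is one with fewest fixed points. *)
Definition nonadj_involution (G : sgraph) (f : {ffun G -> G}) : bool :=
  [forall v, f (f v) == v] && [forall v, ~~ adj v (f v)].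

Definition fixed (G : sgraph) (f : {ffun G -> G}) : {set G} :=
  [set v | f v == v].

Lemma nonadj_involutionP (G : sgraph) (f : {ffun G -> G}) :
  reflect (involutive f /\ forall v, ~~ adj v (f v)) (nonadj_involution f).
Proof.
apply: (iffP andP) => [[/forallP h1 /forallP h2] | [h1 h2]].
  by split=> // v; apply/eqP.
by split; apply/forallP => // v; apply/eqP.
Qed.

Lemma nonadj_involution_min (G : sgraph) : exists f : {ffun G -> G},
  nonadj_involution f /\
  forall g : {ffun G -> G}, nonadj_involution g -> #|fixed f| <= #|fixed g|.
Proof.
have h0 : nonadj_involution (finfun (@id G)).
  by apply/nonadj_involutionP; split=> v; rewrite !ffunE // adj_irrefl.
by case: (arg_minnP (fun f : {ffun G -> G} => #|fixed f|) h0) => f hf fmin;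
  exists f.
Qed.

Section MinimalInvolution.
Variables (G : sgraph) (f : {ffun G -> G}).
Hypothesis f_inv : nonadj_involution f.
Hypothesis f_min : forall g : {ffun G -> G},
  nonadj_involution g -> #|fixed f| <= #|fixed g|.

Let fK : involutive f. Proof. by case/nonadj_involutionP: f_inv. Qed.
Let nadj_f v : ~~ adj v (f v).
Proof. by case/nonadj_involutionP: f_inv => _; apply. Qed.

(** Otherwise [u] and [v] could be matched to each other, leaving fewer fixed points. *)
Lemma fixed_adj u v : f u = u -> f v = v -> u != v -> adj u v.
Proof.
move=> fu fv uv; apply: contraT => nuv.
pose g := [ffun x => if x == u then v else if x == v then u else f x].
have gu : g u = v by rewrite ffunE eqxx.
have gv : g v = u by rewrite ffunE eq_sym (negPf uv) eqxx.
have gE x : x != u -> x != v -> g x = f x.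
  by rewrite ffunE => /negPf -> /negPf ->.
have g_inv : nonadj_involution g.
  apply/nonadj_involutionP; split=> x;
    (have [-> | xu] := eqVneq x u; first by rewrite gu ?gv);
    (have [-> | xv] := eqVneq x v; first by rewrite gv ?gu 1?adj_sym).
    by rewrite !gE ?fK // -?[X in _ != X]fu -?[X in _ != X]fv ?(inj_eq (inv_inj fK)).
  by rewrite gE.
have := f_min g_inv; rewrite leqNgt => /negP[]; apply: proper_card.
apply/properP; split.
  apply/subsetP => x; rewrite !inE.
  have [-> | xu] := eqVneq x u; first by rewrite fu.
  have [-> | xv] := eqVneq x v; first by rewrite fv.
  by rewrite gE.
by exists u; rewrite inE ?fu // gu eq_sym.
Qed.

(* Otherwise [u x (f x) v] would be an augmenting path. *)
Lemma fixed_nonaugmenting u v x :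
  f u = u -> f v = v -> u != v -> f x != x -> adj u x || adj v (f x).
Proof.
move=> fu fv uv fx; apply: contraT; rewrite negb_or => /andP[nux nvfx].
(* Augmentation replaces the pair [x, f x] by the pairs [u, x] and [v, f x]. *)
pose g := [ffun y => if y == u then x else if y == x then u
                     else if y == v then f x else if y == f x then v else f y].
have fI := inj_eq (inv_inj fK).
have ne_fix w y : f w = w -> f y != y -> y != w.
  by move=> fw; apply: contra_neqN => /eqP ->; rewrite fw.
have xu := ne_fix _ _ fu fx; have xv := ne_fix _ _ fv fx.
have ffx : f (f x) != f x by rewrite fI.
have fxu := ne_fix _ _ fu ffx; have fxv := ne_fix _ _ fv ffx.
have gu : g u = x by rewrite ffunE eqxx.
have gx : g x = u by rewrite ffunE (negPf xu) eqxx.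
have gv : g v = f x.
  by rewrite ffunE eq_sym (negPf uv) eq_sym (negPf xv) eqxx.
have gfx : g (f x) = v by rewrite ffunE (negPf fxu) (negPf fx) (negPf fxv) eqxx.
have gE y : y != u -> y != x -> y != v -> y != f x -> g y = f y.
  by rewrite ffunE => /negPf -> /negPf -> /negPf -> /negPf ->.
have g_inv : nonadj_involution g.
  apply/nonadj_involutionP; split=> y;
    (have [-> | yu] := eqVneq y u; first by rewrite gu ?gx);
    (have [-> | yx] := eqVneq y x; first by rewrite gx ?gu 1?adj_sym);
    (have [-> | yv] := eqVneq y v; first by rewrite gv ?gfx);
    (have [-> | yfx] := eqVneq y (f x); first by rewrite gfx ?gv 1?adj_sym).
    rewrite !gE ?fK ?(can2_eq fK fK) ?fu ?fv ?fK //.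
  by rewrite gE.
have := f_min g_inv; rewrite leqNgt => /negP[]; apply: proper_card.
apply/properP; split.
  apply/subsetP => y; rewrite !inE.
  have [-> | yu] := eqVneq y u; first by rewrite fu.
  have [-> | yx] := eqVneq y x; first by rewrite gx eq_sym (negPf xu).
  have [-> | yv] := eqVneq y v; first by rewrite fv.
  have [-> | yfx] := eqVneq y (f x); first by rewrite gfx eq_sym (negPf fxv).
  by rewrite gE.
by exists u; rewrite inE ?fu // gu.
Qed.

End MinimalInvolution.

(** The conditional packages the partition of the vertices into [X], its image under [f], and
    [U]. *)
Lemma oriented_matching (G : sgraph) : alpha G = 2 ->
  exists (f : G -> G) (X U : {set G}),
  [/\ involutive f, forall v, ~~ adj v (f v),
      forall v, if v \in U then (f v == v) && (v \notin X)
                else (f v \in X) == (v \notin X)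
    & forall u v, u \in U -> v \in X :|: U -> u != v -> adj u v].
Proof.
move=> alpha_G; have [f [f_inv f_min]] := nonadj_involution_min G.
have /nonadj_involutionP[fK nadj] := f_inv.
pose free x := [forall u in fixed f, adj u x].
(* If both ends have nonneighbours among the fixed vertices, distinct ones give an augmenting path
   and a common one forms a stable triple with [x] and [f x]. *)
have freeP x : f x != x -> free x || free (f x).
  move=> fx; apply: contraT; rewrite negb_or => /andP[].
  case/forall_inPn=> u uU nux /forall_inPn[v vU nvfx].
  move: uU vU; rewrite !inE => /eqP fu /eqP fv.
  have [uv | uv] := eqVneq u v; last first.
    have := fixed_nonaugmenting f_inv f_min fu fv uv fx.
    by rewrite (negPf nux) (negPf nvfx).
  rewrite -uv in nvfx.
  have ux : u != x by apply: contraNneq fx => <-; rewrite fu.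
  have ufx : u != f x by rewrite -fu (inj_eq (inv_inj fK)).
  by rewrite (alpha2_adj alpha_G ux _ nux (nadj x) ufx) // eq_sym in nvfx.
(* Ranks break the tie when both ends are free. *)
pose r (x : G) : nat := enum_rank x.
pose X := [set x | [&& f x != x, free x & free (f x) ==> (r x < r (f x))]].
exists f, X, (fixed f); split=> //.
- move=> v; rewrite !inE fK; have [fv | fv] := eqVneq (f v) v => //=.
  have := freeP v fv.
  case: (free v); case: (free (f v)) => //= _.
  have : r (f v) != r v by apply: contra_neq fv => /ord_inj/enum_rank_inj.
  by rewrite ltn_neqAle leqNgt => /= ->.
- move=> u v uU; rewrite !inE; case/orP=> [/and3P[_ /forall_inP fr _] _ |].
    exact: fr.
  by move=> /eqP fv; apply: (fixed_adj f_inv f_min) => //; move: uU; rewrite inE => /eqP.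
Qed.

(** * Double counting and two-element sets *)

Lemma card_setIdE (T : finType) (B : {set T}) (P : pred T) :
  #|[set b in B | P b]| = \sum_(b in B) P b.
Proof.
by rewrite -sum1dep_card big_mkcondr; apply: eq_bigr => b _; case: (P b).
Qed.

Lemma double_count (S T : finType) (A : {set S}) (B : {set T})
    (r : S -> T -> bool) :
  \sum_(a in A) #|[set b in B | r a b]| = \sum_(b in B) #|[set a in A | r a b]|.
Proof.
under eq_bigr do rewrite card_setIdE; rewrite exchange_big /=.
by apply: eq_bigr => b _; rewrite card_setIdE.
Qed.

Lemma exists_subset (T : finType) (U : {set T}) k : k <= #|U| ->
  exists2 V : {set T}, V \subset U & #|V| = k.
Proof.
move=> le_k; exists [set x in take k (enum U)].
  by apply/subsetP => x; rewrite inE => /mem_take; rewrite mem_enum.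
rewrite cardsE (card_uniqP _) ?take_uniq ?enum_uniq // size_take -cardE.
by case: ltngtP le_k.
Qed.

Lemma set2_inj (T : finType) (a b c : T) : [set a; b] = [set a; c] -> b = c.
Proof.
move=> E; have := set22 a b; have := set22 a c; rewrite E -{1}E !inE.
by case/orP=> /eqP; [move=> -> /orP[]/eqP | ].
Qed.

Lemma set2_eq (T : finType) (a b c d : T) :
  [set a; b] = [set c; d] -> a = c /\ b = d \/ a = d /\ b = c.
Proof.
move=> E; have := set21 a b; rewrite {1}E !inE => /orP[] /eqP ac.
  by left; split=> //; move: E; rewrite ac => /set2_inj.
by right; split=> //; move: E; rewrite ac (setUC [set c]) => /set2_inj.
Qed.

(** * Middle edges and the routing of nonadjacent terminals *)

Section Routing.
Variables (G : sgraph) (f : G -> G) (X U : {set G}).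
Hypothesis alpha_G : alpha G = 2.
Hypothesis fK : involutive f.
Hypothesis nadj_f : forall v, ~~ adj v (f v).
Hypothesis orient : forall v, if v \in U then (f v == v) && (v \notin X)
                              else (f v \in X) == (v \notin X).
Hypothesis U_adj :
  forall u v, u \in U -> v \in X :|: U -> u != v -> adj u v.

Let f_inj : injective f := inv_inj fK.

Lemma fixed_U v : v \in U -> f v = v.
Proof. by move=> vU; have := orient v; rewrite vU => /andP[/eqP]. Qed.

Lemma X_notin_U v : v \in X -> v \notin U.
Proof.
by move=> vX; have := orient v; case: (v \in U); rewrite // vX andbF.
Qed.

Lemma f_X v : v \in X -> (f v \notin X) && (f v \notin U).
Proof.
move=> vX; have vU := X_notin_U vX; have := orient v.
rewrite (negPf vU) vX => /eqP -> /=; apply/negP => /fixed_U.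
by rewrite fK => vE; have := orient v; rewrite (negPf vU) -vE vX.
Qed.

Lemma f_notX v : v \notin X -> v \notin U -> f v \in X.
Proof.
by move=> vX vU; have := orient v; rewrite (negPf vU) vX => /eqP ->.
Qed.

Lemma sum_matching (g : G -> nat) :
  \sum_w g w = \sum_(v in X) (g v + g (f v)) + \sum_(u in U) g u.
Proof.
rewrite (bigID (mem X)) big_split /= -addnA; congr (_ + _).
rewrite (bigID (mem U)) /= addnC; congr (_ + _); last first.
  apply: eq_bigl => w; rewrite andbC; case: (boolP (w \in U)) => //= wU.
  by apply: contraL wU => /X_notin_U.
rewrite (reindex_inj f_inj); apply: eq_bigl => w /=.
apply/idP/idP => [/andP[h1 h2] | /f_X //].
by have := f_notX h1 h2; rewrite fK.
Qed.

Lemma card_matching : #|G| = #|X|.*2 + #|U|.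
Proof.
by have := sum_matching (fun=> 1); rewrite !sum1_card sum_nat_const -muln2.
Qed.

Definition blocked u v := [&& u != v, ~~ adj u v & ~~ adj (f u) (f v)].
(** Invariant under exchanging [k] and [f k], which lets the count run over matched pairs. The
    condition [adj u (f k)] will keep the middle edge [{k, f u}] apart from [{f u', f v'}] for
    nonadjacent [u'], [v']. *)
Definition joined u k :=
  [&& adj u k, adj u (f k), adj (f u) k & adj (f u) (f k)].

(** The nonadjacencies at [u] and [f u], counted by [g], total at most [2 * omega G]; a matched pair
    or a vertex of [V] without any yields a candidate, and blocked pairs use up two. *)
Lemma card_blocked (V : {set G}) (u : G) :
  V \subset U -> u \in X -> 2 * omega G <= #|X| + #|V| + 1 ->
  #|[set v in X | blocked u v]| <= #|[set k in (f @: X) :|: V | joined u k]|.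
Proof.
move=> sVU uX le_om; pose c (a w : G) : nat := (w != a) && ~~ adj a w.
pose g w := c u w + c (f u) w.
have c_om a : \sum_w c a w <= omega G.
  apply: leq_trans (card_nonneighbors a alpha_G); rewrite cardsE -sum1_card.
  by rewrite [leqRHS]big_mkcond leq_sum // => w _; rewrite /c unfold_in; case: andb.
have g_om : \sum_w g w <= 2 * omega G.
  by rewrite big_split mul2n -addnn leq_add.
have jE : \sum_(v in X) joined u v + \sum_(k in V) joined u k
     <= #|[set k in (f @: X) :|: V | joined u k]|.
  rewrite card_setIdE.
  under [X in _ <= X]eq_bigl => k do
    rewrite in_setU -[_ || _]/(k \in [predU f @: X & V]).
  rewrite bigU /=; last first.
    rewrite disjoint_subset; apply/subsetP => w /imsetP[v /f_X/andP[_ h] ->].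
    by rewrite inE; apply: contra h => /(subsetP sVU).
  rewrite leq_add2r big_imset /=; last by move=> ? ? _ _; apply: f_inj.
  apply: leq_sum => v _; rewrite /joined fK.
  by case: (adj u v); case: (adj u _); case: (adj _ v); case: (adj _ _).
(* A vertex of [V] is adjacent to [u], so it is joined or a nonneighbour of [f u]. *)
have V_le : #|V| <= \sum_(k in V) joined u k + \sum_(k in U) g k.
  apply: leq_trans (_ : \sum_(k in V) joined u k + \sum_(k in V) g k <= _).
    rewrite -big_split -sum1_card leq_sum //= => k /(subsetP sVU) kU.
    have ku : k != u by apply: contraTneq kU => ->; exact: X_notin_U.
    have kfu : k != f u.
      by apply: contraTneq kU => ->; case/andP: (f_X uX).
    have auk : adj u k by rewrite adj_sym U_adj // inE uX.
    rewrite /joined (fixed_U kU) auk /g /c kfu /=.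
    by case: (adj (f u) k) => //=; lia.
  rewrite leq_add2l [leqRHS](big_setID V) /= (setIidPr sVU); lia.
(* The [+ 1] comes from [v = u], where [g] counts the nonadjacency of [u] and [f u] twice. *)
have X_le : #|[set v in X | blocked u v]| + #|X| + 1 <=
    \sum_(v in X) joined u v + \sum_(v in X) (g v + g (f v)).
  have -> : 1 = \sum_(v in X) (v == u).
    by rewrite (bigD1 u uX) /= eqxx big1 // => v /andP[_ /negPf ->].
  rewrite card_setIdE -sum1_card -!big_split /=; apply: leq_sum => v vX.
  have [-> | vu] := eqVneq v u.
    rewrite /blocked eqxx /g /c !eqxx /= (negPf (nadj_f u)) adj_sym.
    rewrite (negPf (nadj_f u)) eq_sym.
    have [E | _] /= := eqVneq u (f u); last by lia.
    by have := f_X uX; rewrite -E uX.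
  have fne w : w \in X -> v != f w /\ f v != w.
    move=> wX; have /andP[h _] := f_X wX; have /andP[h' _] := f_X vX.
    split; [apply: contraNneq h => <- // | apply: contraNneq h' => -> //].
  have [vfu fvu] := fne u uX.
  rewrite /blocked /joined /g /c vu vfu fvu (inj_eq f_inj) vu eq_sym vu /=.
  by case: (adj u v); case: (adj u (f v)); case: (adj (f u) v); case: (adj _ _).
have := sum_matching g; lia.
Qed.

Lemma blocked_sym u v : blocked u v = blocked v u.
Proof. by rewrite /blocked eq_sym adj_sym (adj_sym (f u)). Qed.

(* Each blocked pair of terminals gets a private edge inside [~: T], to be used
   as the middle edge of its path. *)
Lemma helper_edges (V : {set G}) :
  V \subset U -> 2 * omega G <= #|X| + #|V| + 1 ->
  exists h : {set G} -> {set G},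
    (forall u v, u \in X -> v \in X -> blocked u v ->
       exists a b k, [/\ [set u; v] = [set a; b], k \in (f @: X) :|: V,
                         joined a k & h [set u; v] = [set f a; k]]) /\
    (forall u v u' v', u \in X -> v \in X -> blocked u v ->
       u' \in X -> v' \in X -> blocked u' v' ->
       h [set u; v] = h [set u'; v'] -> [set u; v] = [set u'; v']).
Proof.
move=> sVU le_om; set N := _ :|: V.
pose D := [set [set uv.1; uv.2] | uv in [set uv : G * G |
             [&& uv.1 \in X, uv.2 \in X & blocked uv.1 uv.2]]].
have inD u v : u \in X -> v \in X -> blocked u v -> [set u; v] \in D.
  by move=> uX vX buv; apply/imsetP; exists (u, v); rewrite // inE uX vX.
have DP e : e \in D ->
    exists u v, [/\ u \in X, v \in X, blocked u v & e = [set u; v]].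
  by case/imsetP=> -[u v]; rewrite inE => /and3P[? ? ?] ->; exists u, v.
(* Either end of [e] may act as [a], whose partner [f a] lies on the middle edge. *)
pose W (e : {set G}) : {set {set G}} :=
  [set [set f ak.1; ak.2] | ak in [set ak : G * G |
     [&& ak.1 \in e, ak.2 \in N & joined ak.1 ak.2]]].
(* Double counting: each pair in [S] has two ends, each edge in [B] contains [f u] for at most two
   [u], and [card_blocked] compares the degrees at each [u]. *)
have hallW (S : {set {set G}}) : S \subset D -> #|S| <= #|\bigcup_(e in S) W e|.
  move=> sSD; set B := \bigcup_(e in S) W e; pose C := \bigcup_(e in S) e.
  have CX u : u \in C -> u \in X.
    case/bigcupP=> e /(subsetP sSD)/DP[a [b [aX bX _ ->]]].
    by rewrite !inE => /orP[] /eqP ->.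
  rewrite -(leq_pmul2l (isT : 0 < 2)).
  have -> : 2 * #|S| = \sum_(u in C) #|[set e in S | u \in e]|.
    rewrite double_count mulnC -sum_nat_const; apply: eq_bigr => e eS.
    have /DP[u [v [_ _ /and3P[uv _ _] eE]]] := subsetP sSD e eS.
    have -> : [set a in C | a \in e] = e; last by rewrite eE cards2 uv.
    apply/setP => a; rewrite inE andbC; case: (boolP (a \in e)) => //= ae.
    by apply/bigcupP; exists e.
  apply: (@leq_trans (\sum_(u in C) #|[set w in B | f u \in w]|)); last first.
    rewrite double_count mulnC -sum_nat_const; apply: leq_sum => w.
    case/bigcupP=> e _ /imsetP[[a k] _ ->] /=.
    rewrite -(card_imset _ f_inj); apply: leq_trans (_ : #|[set f a; k]| <= 2).
      apply: subset_leq_card; apply/subsetP => x /imsetP[u]; rewrite inE.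
      by case/andP=> _ ? ->.
    by rewrite cards2; case: (_ != _).
  apply: leq_sum => u uC; have uX := CX u uC.
  apply: leq_trans (leq_trans (card_blocked sVU uX le_om) _).
    apply: leq_trans (leq_imset_card (fun v => [set u; v]) _).
    apply: subset_leq_card; apply/subsetP => e; rewrite inE => /andP[eS].
    have /DP[a [b [aX bX bab ->]]] := subsetP sSD e eS.
    rewrite !inE => /orP[] /eqP ->; apply/imsetP.
      by exists b; rewrite // inE bX.
    by exists a; rewrite 1?setUC // inE aX blocked_sym.
  rewrite -(card_in_imset (f := fun k => [set f u; k])); last first.
    by move=> k k' _ _; apply: set2_inj.
  apply: subset_leq_card; apply/subsetP => w /imsetP[k]; rewrite inE.
  case/andP=> kN juk ->; rewrite !inE eqxx andbT.
  case/bigcupP: uC => e eS ue; apply/bigcupP; exists e => //.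
  by apply/imsetP; exists (u, k); rewrite // inE /= ue kN.
have [h [hW hI]] := hall set0 hallW; exists h; split=> [u v uX vX buv | ].
  have /imsetP[[a k]] := hW _ (inD u v uX vX buv).
  rewrite inE /= => /and3P[auv kN jak ->].
  case: (eqVneq a u) auv jak => [-> _ juk | au auv jak]; first by exists u, v, k.
  exists a, u, k; split=> //; move: auv; rewrite !inE (negPf au) /= => /eqP ->.
  exact: setUC.
by move=> u v u' v' uX vX buv uX' vX' buv'; apply: hI; apply: inD.
Qed.

Definition nonadj_pair u v := [&& u \in X, v \in X, u != v & ~~ adj u v].

Definition routed (V : {set G}) (w : {set G}) a b k :=
  [&& k \in (f @: X) :|: V, adj a k, adj k (f a), adj (f a) b
    & w == [set f a; k]].

Lemma nonadj_pair_sym u v : nonadj_pair u v = nonadj_pair v u.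
Proof. by rewrite /nonadj_pair eq_sym adj_sym andbCA. Qed.

(** Blocked pairs get their helper edge, the others [[set f u; f v]]. The last clause, which also
    covers blocked [u', v'], prevents the first edge of one path from being the last edge of
    another. *)
Lemma middle_edges (V : {set G}) :
  V \subset U -> 2 * omega G <= #|X| + #|V| + 1 ->
  exists w : {set G} -> {set G},
    [/\ forall u v, nonadj_pair u v -> exists a b k,
          [/\ [set u; v] = [set a; b], nonadj_pair a b
            & routed V (w [set u; v]) a b k],
        forall u v u' v', nonadj_pair u v -> nonadj_pair u' v' ->
          w [set u; v] = w [set u'; v'] -> [set u; v] = [set u'; v']
      & forall u v u' v', nonadj_pair u v -> nonadj_pair u' v' ->
          w [set u; v] = [set f u'; f v'] -> [set u; v] = [set u'; v']].
Proof.
move=> sVU le_om; have [h [hP hI]] := helper_edges sVU le_om.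
(* [w] takes an unordered pair, so blockedness is read off the set. *)
pose good (e : {set G}) := [forall x in e, forall y in e, ~~ blocked x y].
pose w e := if good e then f @: e else h e.
have goodE u v : good [set u; v] = ~~ blocked u v.
  have bxx x : blocked x x = false by rewrite /blocked eqxx.
  apply/idP/idP => [/forall_inP/(_ _ (set21 _ _))/forall_inP|].
    by apply; rewrite set22.
  move=> nb; apply/forall_inP => x; rewrite !inE => /orP[] /eqP ->;
    apply/forall_inP => y; rewrite !inE => /orP[] /eqP ->;
    by rewrite ?bxx // blocked_sym.
have wE u v : w [set u; v] =
    if blocked u v then h [set u; v] else [set f u; f v].
  by rewrite /w goodE; case: blocked => //=; rewrite imsetU !imset_set1.
have star u v u' v' : nonadj_pair u v -> nonadj_pair u' v' ->
    w [set u; v] = [set f u'; f v'] -> [set u; v] = [set u'; v'].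
  move=> /and4P[uX vX _ _] /and4P[_ _ _ nuv']; rewrite wE.
  case: ifP => [buv | _].
    (* Were [{f a, k}] equal to [{f u', f v'}], then [a] and [f k] would be [u'] and [v'] in some
       order, which are nonadjacent, contrary to [joined a k]. *)
    have [a [b [k [_ _ jak ->]]]] := hP _ _ uX vX buv.
    move: jak => /and4P[_ ak _ _] /set2_eq[[/f_inj E kE] | [/f_inj E kE]].
      by rewrite kE fK E (negPf nuv') in ak.
    by rewrite kE fK E adj_sym (negPf nuv') in ak.
  by case/set2_eq=> [[/f_inj -> /f_inj ->] // | [/f_inj -> /f_inj ->]]; apply: setUC.
(* Both [f a] and [b] are nonneighbours of [a]. *)
have adj_fX a b : nonadj_pair a b -> adj (f a) b.
  case/and4P=> aX bX ab nab; have /andP[faX _] := f_X aX.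
  apply: (@alpha2_adj _ _ a) => //.
  - by apply: contraNneq faX => ->.
  - by rewrite adj_sym.
  - by apply: contraNneq faX => ->.
exists w; split=> // [u v nuv | u v u' v' nuv nuv'].
  have /and4P[uX vX uv naduv] := nuv; rewrite wE; case: ifP => [buv | nbuv].
    have [a [b [k [eE kN jak ->]]]] := hP _ _ uX vX buv.
    have nab : nonadj_pair a b.
      by case: (set2_eq eE) nuv => [[-> ->] | [-> ->]]; rewrite 1?nonadj_pair_sym.
    exists a, b, k; split=> //; case/and4P: jak => ak _ fak _.
    by apply/and5P; split=> //; [rewrite adj_sym | apply: adj_fX].
  exists u, v, (f v); split=> //; apply/and5P; split=> //.
  - by rewrite inE imset_f.
  - by rewrite adj_sym adj_fX // nonadj_pair_sym.
  - by move: nbuv; rewrite /blocked uv naduv /= adj_sym => /negbFE.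
  - exact: adj_fX.
have [uX vX _ _] := and4P nuv; have [uX' vX' _ _] := and4P nuv'.
have [buv | nbuv] := boolP (blocked u v); last first.
  rewrite [w [set u; v]]wE (negPf nbuv) => /esym/star E.
  by rewrite E.
have [buv' | nbuv'] := boolP (blocked u' v'); last first.
  by rewrite [w [set u'; v']]wE (negPf nbuv') => /star ->.
by rewrite !wE buv buv'; apply: hI.
Qed.

(** Adjacent terminals use their edge, the others a detour [a, k, f a, b] with both inner vertices
    outside [T]; conflicts between detours reduce to middle edges. *)
Lemma immersion_of_matching (V : {set G}) :
  V \subset U -> 2 * omega G <= #|X| + #|V| + 1 ->
  contains_totally_odd_immersion (complete #|X :|: (U :\: V)|) G.
Proof.
move=> sVU le_om; set T := X :|: _.
have [w [wP wI w_star]] := middle_edges sVU le_om.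
have N_T k : k \in (f @: X) :|: V -> k \notin T.
  rewrite !inE => /orP[/imsetP[v vX ->] | kV].
    by have /andP[/negPf -> /negPf ->] := f_X vX; rewrite andbF.
  by rewrite kV orbF; apply: contraL (subsetP sVU k kV) => /X_notin_U.
have sXT u : u \in X -> u \in T by rewrite inE => ->.
have fX_T u : u \in X -> f u \notin T.
  by move=> uX; apply: N_T; rewrite inE imset_f.
have NA u v : u \in T -> v \in T -> u != v -> ~~ adj u v -> nonadj_pair u v.
  have sTXU x : x \in T -> x \in X :|: U.
    by rewrite !inE => /orP[-> | /andP[_ ->]]; rewrite ?orbT.
  move=> uT vT uv nuv; apply/and4P; split=> //.
    have := sTXU u uT; rewrite inE => /orP[// | uU].
    by rewrite U_adj ?sTXU in nuv.
  have := sTXU v vT; rewrite inE => /orP[// | vU].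
  by rewrite adj_sym U_adj ?sTXU // eq_sym in nuv.
(* [pick] fixes one orientation per unordered pair; [[::]] is never reached for distinct
   terminals. *)
pose Q (e : {set G}) : seq G :=
  if [pick p : G * G | (e == [set p.1; p.2]) && adj p.1 p.2] is Some p
  then [:: p.1; p.2]
  else if [pick p : G * G * G | [&& e == [set p.1.1; p.1.2],
             nonadj_pair p.1.1 p.1.2 & routed V (w e) p.1.1 p.1.2 p.2]]
       is Some p then [:: p.1.1; p.2; f p.1.1; p.1.2] else [::].
have QP u v : u \in T -> v \in T -> u != v -> exists a b,
    [/\ [set u; v] = [set a; b], a \in T, b \in T, a != b &
     (adj a b /\ Q [set u; v] = [:: a; b]) \/
     (nonadj_pair a b /\ exists2 k, routed V (w [set u; v]) a b k
                                  & Q [set u; v] = [:: a; k; f a; b])].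
  move=> uT vT uv; have abT a b : [set u; v] = [set a; b] ->
      [/\ a \in T, b \in T & a != b].
    by case/set2_eq=> -[<- <-]; split=> //; rewrite eq_sym.
  rewrite /Q; case: pickP => [[a b] /= /andP[/eqP E ab] | no].
    by have [? ? ?] := abT _ _ E; exists a, b; split=> //; left.
  have nuv : ~~ adj u v.
    by have := no (u, v); rewrite /= eqxx /= => ->.
  case: pickP => [[[a b] k] /= /and3P[/eqP E nab rk] | no'].
    have [? ? ?] := abT _ _ E; exists a, b; split=> //; right; split=> //.
    by exists k.
  have [a [b [k [E nab rk]]]] := wP _ _ (NA _ _ uT vT uv nuv).
  by have := no' (a, b, k); rewrite /= {1}E eqxx nab rk.
apply: (@immersion_of_paths G T Q) => [u v uT vT uv | u v u' v' uT vT uv].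
  have [a [b [-> aT bT ab]]] := QP u v uT vT uv.
  case=> [[adjab ->] | [nab [k /and5P[kN ak kfa fab _] ->]]].
    by split=> //; first by rewrite /= adjab inE ab.
  have [aX bX _ _] := and4P nab; have faT := fX_T a aX; have kT := N_T k kN.
  split=> //; last by move=> x; rewrite /= in_cons mem_seq1 => /orP[] /eqP ->.
  rewrite /= ak kfa fab !inE !negb_or ab /=.
  have neT x y : x \in T -> y \notin T -> x != y.
    by move=> xT; apply: contraNneq => <-.
  rewrite !(neT a) // (eq_sym k b) (eq_sym (f a) b) !(neT b) // !andbT .
  by apply: contraTneq kfa => ->; rewrite adj_irrefl.
move=> uT' vT' uv' neq d.
have [a [b [E aT bT ab]]] := QP u v uT vT uv.
have [a' [b' [E' aT' bT' ab']]] := QP u' v' uT' vT' uv'.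
have pathE (x y z t : G) : d \in path_edges [:: x; y; z; t] ->
    [\/ d = [set x; y], d = [set y; z] | d = [set z; t]].
  rewrite /path_edges /= !in_cons in_nil orbF.
  by case/or3P=> /eqP ->; [constructor 1 | constructor 2 | constructor 3].
have edgeE (x y : G) : d \in path_edges [:: x; y] -> d = [set x; y].
  by rewrite mem_seq1 => /eqP.
have outT x y z t : x \notin T -> y \in T -> z \in T ->
    [set x; t] = [set y; z] -> False.
  by move=> xT yT zT /set2_eq[[xy _] | [xz _]]; move: xT; rewrite ?xy ?xz ?yT ?zT.
(* Every edge of a detour contains [k1] or [f a1], hence a nonterminal. *)
have crossing x y a1 k1 b1 : x \in T -> y \in T -> nonadj_pair a1 b1 ->
    k1 \in (f @: X) :|: V -> d \in path_edges [:: x; y] ->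
    d \notin path_edges [:: a1; k1; f a1; b1].
  move=> xT yT /and4P[a1X _ _ _] /N_T k1T /edgeE dE; apply/negP => /pathE.
  have fT := fX_T _ a1X.
  by case=> E1; move: dE; rewrite E1 1?[[set a1; _]]setUC; apply: outT.
case=> [[_ ->] | [nab' [k' /and5P[kN' ak' kfa' _ /eqP wE'] ->]]];
  case=> [[_ ->] | [nab [k /and5P[kN ak kfa _ /eqP wE] ->]]].
- move=> /edgeE dE; apply/negP => /edgeE dE'; move: neq.
  by rewrite E E' -dE -dE' eqxx.
- by move=> h; apply: contraL h; apply: crossing.
- exact: crossing.
have nuv : nonadj_pair u v.
  by case: (set2_eq E) nab => -[-> ->] //; rewrite nonadj_pair_sym.
have nuv' : nonadj_pair u' v'.
  by case: (set2_eq E') nab' => -[-> ->] //; rewrite nonadj_pair_sym.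
(* [K1] excludes equal first or equal middle edges; [K2] and [K3] exclude that the first edge of one
   detour is the last edge of the other. *)
have K1 : [set f a; k] = [set f a'; k'] -> False.
  by rewrite -wE -wE' => /wI => /(_ nuv nuv') EE; rewrite EE eqxx in neq.
have K2 : [set f a; k] = [set f a'; f b'] -> False.
  by rewrite -wE => /w_star => /(_ nuv nab'); rewrite -E' => EE; rewrite EE eqxx in neq.
have K3 : [set f a'; k'] = [set f a; f b] -> False.
  by rewrite -wE' => /w_star => /(_ nuv' nab); rewrite -E => EE; rewrite EE eqxx in neq.
have [[aX _ _ _] [aX' _ _ _]] := (and4P nab, and4P nab').
have [/negbTE kT /negbTE kT'] := (N_T k kN, N_T k' kN').
have [/negbTE faT /negbTE faT'] := (fX_T a aX, fX_T a' aX').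
move=> /pathE dE; apply/negP => /pathE dE'.
have neTr x y : x \in T -> (y \in T) = false -> x = y -> False.
  by move=> xT yT xy; rewrite -xy xT in yT.
case: dE dE' => -> [] /set2_eq[] [e1 e2];
  try by [exact: neTr e1 | exact: neTr e2
         | exact: neTr (esym e1) | exact: neTr (esym e2)].
- by apply: K1; rewrite e1 e2.
- by apply: K2; rewrite e1 e2 setUC.
- by apply: K1; rewrite e1 e2.
- by apply: K1; rewrite e1 e2 setUC.
- by apply: K3; rewrite -e1 e2 setUC.
- by move: neq; rewrite E E' e2 (f_inj e1) eqxx.
Qed.

End Routing.

Theorem theorem1p6 (n : nat) (G : sgraph) (card_G : #|G| = n)
    (alpha_G : alpha G = 2)
    (omega_G : omega G < if odd n then ceil_div (n + 3) 4 else ceil_div n 4) :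
  contains_totally_odd_immersion (complete (ceil_div n 2)) G.
Proof.
have [f [X [U [fK nadj_f orient U_adj]]]] := oriented_matching alpha_G.
have cardG := card_matching fK orient.
(* Rounding down here leaves the larger half of [U] as terminals, which gives [n / 2] rounded up in
   total. *)
have [V sVU cardV] := exists_subset (leq_div #|U| 2).
have -> : ceil_div n 2 = #|X :|: (U :\: V)|.
  rewrite cardsU cardsD (setIidPr sVU) cardV -card_G cardG /ceil_div.
  suff -> : X :&: (U :\: V) = set0 by rewrite cards0; lia.
  apply/setP => v; rewrite !inE; case: (boolP (v \in X)) => //= vX.
  by rewrite (negPf (X_notin_U orient vX)) andbF.
apply: immersion_of_matching => //.
(* Here [#|X| + #|V|] is [n / 2] rounded down; the inequality is tight for [n] congruent to 3 modulo
   4. *)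
by move: omega_G; rewrite cardV -card_G cardG /ceil_div; case: ifP; lia.
Qed.
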